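(* Let $k\ge 3$ and $n$ be integers with $n>3k-3$, let $0\le h\le 2n$ be an integer, and let $H$ be a blue cycle of length $n+h$. Then $\tilde{r}_H(C_k,C_n)\le 3k+10$.
   Context: Online Ramsey game: Builder and Painter play on the infinite complete graph $K_{\mathbb N}$. For a colored graph $H$ (each edge red or blue), the game $\tilde R_H(G_1,G_2)$ starts with a copy of $H$ already drawn and colored on the board. In each round Builder selects a previously unselected edge of $K_{\mathbb N}$ and Painter colors it red or blue. The game ends as soon as the graph of all colored edges (the host graph) contains a red copy of $G_1$ or a blue copy of $G_2$. $\tilde{r}_H(G_1,G_2)$ is the minimum number of rounds within which Builder can guarantee the end of the game, both players playing optimally. $C_k$ is the cycle on $k$ vertices; a blue cycle is a cycle all of whose edges are blue. *)

(* Defs.v *)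
From mathcomp Require Import all_boot.

Set Implicit Arguments.
Unset Strict Implicit.
Unset Printing Implicit Defensive.

Record sgraph (V : Type) := SGraph {
  adj :> rel V;
  adj_sym : symmetric adj;
  adj_irr : irreflexive adj
}.

Inductive colour := Red | Blue.

(* [C u v = Some c] means that uv is an edge of colour c; [C u v = None] means
   that uv is not an edge. *)
Record cgraph (V : Type) := CGraph {
  colour_of :> V -> V -> option colour;
  colour_sym : forall u v, colour_of u v = colour_of v u;
  colour_irr : forall v, colour_of v v = None
}.

Section Mono.
Variables (V : Type) (c : colour) (G : sgraph V).

Definition mono_colour (u v : V) : option colour :=
  if G u v then Some c else None.

Fact mono_sym u v : mono_colour u v = mono_colour v u.
Proof. by rewrite /mono_colour adj_sym. Qed.

Fact mono_irr v : mono_colour v v = None.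
Proof. by rewrite /mono_colour adj_irr. Qed.

Definition monochromatic : cgraph V := CGraph mono_sym mono_irr.

End Mono.

Section Cycle.
Variable k : nat.

(* [ordS] is the successor modulo k. The conjunct [i != j] only matters when
   k = 1; this is the k-cycle for k >= 3. *)
Definition cycle_adj : rel 'I_k :=
  fun i j => (i != j) && ((ordS i == j) || (ordS j == i)).

Fact cycle_adj_sym : symmetric cycle_adj.
Proof. by move=> i j; rewrite /cycle_adj eq_sym orbC. Qed.

Fact cycle_adj_irr : irreflexive cycle_adj.
Proof. by move=> i; rewrite /cycle_adj eqxx. Qed.

Definition cycle_graph : sgraph 'I_k := SGraph cycle_adj_sym cycle_adj_irr.

End Cycle.

(* A board records which edges of the complete graph on [nat] have been
   selected, and their colours. *)
Definition board := cgraph nat.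

Section Paint.
Variables (B : board) (u v : nat) (c : colour).

Definition paint_colour (x y : nat) : option colour :=
  if (u != v) && (((x == u) && (y == v)) || ((x == v) && (y == u)))
  then Some c else B x y.

Fact paint_sym x y : paint_colour x y = paint_colour y x.
Proof.
by rewrite /paint_colour colour_sym orbC [(x == v) && _]andbC
  [(x == u) && _]andbC.
Qed.

Fact paint_irr x : paint_colour x x = None.
Proof.
rewrite /paint_colour colour_irr; case: ifP => // /andP[/negP uv].
by case/orP=> /andP[/eqP xu /eqP xv]; case: uv; rewrite -xu -xv.
Qed.

Definition paint : board := CGraph paint_sym paint_irr.

End Paint.

Section Game.
Variables (V1 V2 : finType) (G1 : sgraph V1) (G2 : sgraph V2).

(* Copies are not required to be induced. *)
Definition has_copy (V : finType) (c : colour) (G : sgraph V) (B : board) :=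
  exists2 f : V -> nat, injective f &
    forall x y, G x y -> B (f x) (f y) = Some c.

Definition game_over (B : board) : Prop :=
  has_copy Red G1 B \/ has_copy Blue G2 B.

Fixpoint builder_wins (t : nat) (B : board) : Prop :=
  game_over B \/
  match t with
  | 0 => False
  | t'.+1 => exists u v : nat,
      [/\ u != v, B u v = None & forall c, builder_wins t' (paint B u v c)]
  end.

(* The coloured edges of B are exactly those of a copy of H. *)
Definition drawing (W : finType) (H : cgraph W) (B : board) : Prop :=
  exists f : W -> nat,
    [/\ injective f,
        forall x y, B (f x) (f y) = H x y &
        forall u v, B u v <> None -> exists x y, u = f x /\ v = f y].

(* Where the copy of H is drawn is immaterial, since any bijection between
   finite subsets of [nat] extends to a permutation of [nat]. *)
Definition guaranteed_within (W : finType) (H : cgraph W) (t : nat) : Prop :=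
  forall B, drawing H B -> builder_wins t B.

Definition is_online_ramsey_number (W : finType) (H : cgraph W) (r : nat) :=
  guaranteed_within H r /\ forall t, guaranteed_within H t -> r <= t.

End Game.

(* Main.v *)
(* Number the blue cycle 0, ..., n + h - 1. A blue chord of length s turns it into
   a blue cycle of length n + (h + 1 - s); so a chord of length h + 1 must be red,
   and two crossing chords ij, xy with (x - i) + (y - j) = h + 2 cannot both be
   blue, since replacing the arcs ix and jy by the chords gives a blue C_n. For
   h = 1 and h = 2 Builder closes a red path of chords of length h + 1 by one more
   chord; if that chord is blue, a crossing chord closes a translate of the path.
   In general Painter cannot afford a blue chord of length h either, since it leads
   to h = 1. A red path zigzagging with steps h + 1 and -h is closed as above when
   h is small compared with n; for larger h it is closed through one extra vertex
   z, by two chords whose length makes h drop by about half if one of them is blue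
   (for k odd), or drop to at most k / 2 (for k even). Five halvings, at two rounds
   each, bring any h <= 2n down to the small case. *)
Require Import Defs.
From mathcomp Require Import all_boot.
From mathcomp Require Import zify.
From Stdlib Require Import Classical.

Set Implicit Arguments.
Unset Strict Implicit.
Unset Printing Implicit Defensive.

(** * Shortening blue cycles by chords *)

Definition coloured_cycle (c : colour) (l : nat) (f : nat -> nat) (B : board) :=
  [/\ forall i j, i < l -> j < l -> f i = f j -> i = j,
      forall i, i.+1 < l -> B (f i) (f i.+1) = Some c
    & B (f l.-1) (f 0) = Some c].

Lemma coloured_cycle_copy c l f (B : board) :
  coloured_cycle c l f B -> has_copy c (cycle_graph l) B.
Proof.
move=> [f_inj f_edge f_last].
exists (fun i : 'I_l => f i); first by move=> i j /f_inj ij; apply/val_inj/ij.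
have succ (i : 'I_l) : B (f i) (f (ordS i)) = Some c.
  have := ltn_ord i; rewrite leq_eqVlt => /orP[/eqP il|il] /=.
    by rewrite il modnn -[nat_of_ord i]/(i.+1.-1) il.
  by rewrite modn_small // f_edge.
move=> x y /= /andP[_ /orP[/eqP<-|/eqP<-]]; first exact: succ.
by rewrite colour_sym; exact: succ.
Qed.

Definition extends (B B' : board) :=
  forall u v c, B u v = Some c -> B' u v = Some c.

Lemma extends_trans B1 B2 B3 : extends B1 B2 -> extends B2 B3 -> extends B1 B3.
Proof. by move=> e12 e23 u v c /e12/e23. Qed.

Lemma coloured_cycle_extends c l f B B' :
  extends B B' -> coloured_cycle c l f B -> coloured_cycle c l f B'.
Proof. by move=> e [? ? ?]; split=> // *; apply: e; auto. Qed.

Lemma paint_extends (B : board) u v c : B u v = None -> extends B (paint B u v c).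
Proof.
move=> Buv x y d Bxy /=; rewrite /paint_colour.
case: ifP => // /andP[_ /orP[] /andP[/eqP xE /eqP yE]].
  by move: Bxy; rewrite xE yE Buv.
by move: Bxy; rewrite xE yE colour_sym Buv.
Qed.

Lemma chord_cycle m f (B : board) i j :
  coloured_cycle Blue m f B -> i < j -> j < m -> B (f i) (f j) = Some Blue ->
  exists g, coloured_cycle Blue (m - (j - i) + 1) g B.
Proof.
move=> [f_inj f_edge f_last] ij jm chord.
exists (fun t => f (if t <= i then t else t + (j - i) - 1)); split.
- move=> s t s_lt t_lt; case: ifP => ?; case: ifP => ? /f_inj; lia.
- move=> t t_lt; case: (ltngtP t i) => [ti|ti|->].
  + by apply: f_edge; lia.
  + rewrite (_ : t.+1 + _ - 1 = (t + (j - i) - 1).+1); last lia.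
    by apply: f_edge; lia.
  + by rewrite (_ : i.+1 + _ - 1 = j) //; lia.
- rewrite ifF; last lia.
  by rewrite (_ : _ - 1 = m.-1) //; lia.
Qed.

Lemma crossing_chords_cycle m f (B : board) i x j y :
  coloured_cycle Blue m f B -> i < x -> x < j -> j < y -> y < m ->
  B (f i) (f j) = Some Blue -> B (f x) (f y) = Some Blue ->
  exists g, coloured_cycle Blue (m - (x - i) - (y - j) + 2) g B.
Proof.
move=> [f_inj f_edge f_last] ix xj jy ym chord1 chord2.
(* The new cycle runs up to [i], jumps to [j], goes back down to [x], jumps to [y] and runs on to
   [m.-1]. *)
pose idx t := if t <= i then t else if t <= i + (j - x) + 1
  then j + i + 1 - t else t + (x - i) + (y - j) - 2.
exists (fun t => f (idx t)); split.
- move=> s t s_lt t_lt; rewrite /idx.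
  by do 4?case: ifP => ?; move=> /f_inj; lia.
- move=> t t_lt; case: (ltngtP t i) => [ti|ti|ti].
  + by rewrite /idx ltnW // ti; apply: f_edge; lia.
  + case: (ltngtP t (i + (j - x) + 1)) => [tx|tx|tx].
    * rewrite colour_sym (_ : idx t = (idx t.+1).+1) ?f_edge // /idx;
      by do 4?case: ifP => ?; lia.
    * rewrite (_ : idx t.+1 = (idx t).+1) ?f_edge // /idx;
      by do 4?case: ifP => ?; lia.
    * rewrite (_ : idx t = x) 1?(_ : idx t.+1 = y) // /idx;
      by do 2?case: ifP => ?; lia.
  + rewrite (_ : idx t = i) 1?(_ : idx t.+1 = j) // /idx;
    by do 2?case: ifP => ?; lia.
- rewrite (_ : idx _ = m.-1) // /idx; by do 2?case: ifP => ?; lia.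
Qed.

(** * Basic moves of Builder *)

Section Strategy.
Variables k n : nat.
Hypothesis k_ge3 : 3 <= k.
Hypothesis n_large : 3 * k - 3 < n.

Local Notation wins := (builder_wins (cycle_graph k) (cycle_graph n)).

Lemma wins_leq t t' B : t <= t' -> wins t B -> wins t' B.
Proof.
move=> /subnKC <-; move: (t' - t) => d {t'}.
elim: t B => [|t IH] B; first by case=> [over|[]]; case: d => [|d]; left.
case=> [over|[u [v [uv Buv win]]]]; first by left.
by rewrite addSn; right; exists u, v; split=> // c; apply/IH/win.
Qed.

(** An edge that is already coloured saves the round, so strategies need not track which edges have
    been selected. *)
Lemma wins_query t (B : board) u v : u <> v ->
  (forall B' c, extends B B' -> B' u v = Some c -> wins t B') -> wins t.+1 B.
Proof.
move=> /eqP uv win; case Buv: (B u v) => [c|].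
  by apply: (@wins_leq t) => //; apply: win Buv.
right; exists u, v; split=> // c; apply: (win _ c); first exact: paint_extends.
by rewrite /= /paint_colour uv !eqxx.
Qed.

(** Builder queries the path from its far end back to [g 0]; the first blue answer hands over to a
    strategy with [t] rounds. *)
Lemma wins_red_cycle t (B : board) g :
  (forall i j, i < k -> j < k -> g i = g j -> i = j) ->
  (forall i B', i.+1 < k -> extends B B' ->
    B' (g i) (g i.+1) = Some Blue -> wins t B') ->
  B (g k.-1) (g 0) = Some Red -> wins (k.-1 + t) B.
Proof.
move=> g_inj g_blue g_last.
suff red_path l B' : l < k -> extends B B' ->
    (forall i, l <= i -> i.+1 < k -> B' (g i) (g i.+1) = Some Red) ->
    wins (l + t) B'.
  by apply: red_path => //; lia.
elim: l B' => [|l IH] B' lk eB red.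
  apply: (@wins_leq 0) => //; left; left.
  apply: (@coloured_cycle_copy _ _ g); split; auto.
rewrite addSn; apply: (@wins_query _ _ (g l) (g l.+1)).
  by move=> /g_inj; lia.
move=> B2 [] e2 Bl.
  apply: IH; [lia|exact: extends_trans e2|move=> i li ik].
  have [->//|l_lt] := eqVneq i l.
  by apply: e2; apply: red; lia.
apply: (@wins_leq t); first lia.
by apply: (g_blue l) => //; apply: extends_trans e2.
Qed.

(** Other coloured edges are allowed on [B], so this applies again to shorter blue cycles found
    during the game. *)
Definition beats h t :=
  forall B f, coloured_cycle Blue (n + h) f B -> wins t B.

Lemma beats_leq h t t' : t <= t' -> beats h t -> beats h t'.
Proof. by move=> tt' win B f /win; apply: wins_leq. Qed.

Lemma beats0 : beats 0 0.
Proof.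
by move=> B f; rewrite addn0 => /coloured_cycle_copy blue; left; right.
Qed.

Section Board.
Variables (h : nat) (f : nat -> nat).

Local Notation blue_cycle := (coloured_cycle Blue (n + h) f).

Lemma wins_chord h' t (B : board) i j : blue_cycle B -> beats h' t ->
  i < j -> j < n + h -> j - i + h' = h + 1 -> B (f i) (f j) = Some Blue ->
  wins t B.
Proof.
move=> cyc win ij jm hE chord.
have [g] := chord_cycle cyc ij jm chord.
by rewrite (_ : _ + 1 = n + h'); [apply: win | lia].
Qed.

Lemma wins_crossing (B : board) i x j y : blue_cycle B ->
  i < x -> x < j -> j < y -> y < n + h -> x - i + (y - j) = h + 2 ->
  B (f i) (f j) = Some Blue -> B (f x) (f y) = Some Blue -> wins 0 B.
Proof.
move=> cyc ix xj jy ym hE chord1 chord2.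
have [g] := crossing_chords_cycle cyc ix xj jy ym chord1 chord2.
by rewrite (_ : _ + 2 = n + 0); [apply: beats0 | lia].
Qed.

Lemma index_neq B i j : blue_cycle B -> i < n + h -> j < n + h -> i <> j ->
  f i <> f j.
Proof. by case=> f_inj _ _ im jm ij /f_inj; auto. Qed.

Lemma index_cycle_inj B idx : blue_cycle B ->
  (forall i, i < k -> idx i < n + h) ->
  (forall i j, i < k -> j < k -> idx i = idx j -> i = j) ->
  forall i j, i < k -> j < k -> f (idx i) = f (idx j) -> i = j.
Proof. by case=> f_inj _ _ idx_lt idx_inj i j ? ? /f_inj; auto. Qed.

End Board.

Lemma wins_query_index h f t B i j : coloured_cycle Blue (n + h) f B ->
  i < n + h -> j < n + h -> i <> j ->
  (forall B', coloured_cycle Blue (n + h) f B' -> extends B B' ->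
    B' (f i) (f j) = Some Red -> wins t B') ->
  (forall B', coloured_cycle Blue (n + h) f B' -> extends B B' ->
    B' (f i) (f j) = Some Blue -> wins t B') ->
  wins t.+1 B.
Proof.
move=> cyc im jm ij red blue.
apply: (wins_query (index_neq cyc im jm ij)) => B' [] eB e;
  have cyc' := coloured_cycle_extends eB cyc; by [apply: red | apply: blue].
Qed.

Lemma wins_red_index_cycle h f t (B : board) idx : coloured_cycle Blue (n + h) f B ->
  (forall i, i < k -> idx i < n + h) ->
  (forall i j, i < k -> j < k -> idx i = idx j -> i = j) ->
  (forall i B', i.+1 < k -> coloured_cycle Blue (n + h) f B' -> extends B B' ->
    B' (f (idx i)) (f (idx i.+1)) = Some Blue -> wins t B') ->
  B (f (idx k.-1)) (f (idx 0)) = Some Red -> wins (k.-1 + t) B.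
Proof.
move=> cyc idx_lt idx_inj blue last.
apply: (wins_red_cycle (g := fun i => f (idx i))) => //.
  exact: index_cycle_inj cyc idx_lt idx_inj.
move=> i B' ik eB; apply: blue => //; exact: coloured_cycle_extends cyc.
Qed.


Lemma wins_forced_chord h f (B : board) i j : coloured_cycle Blue (n + h) f B ->
  j < n + h -> j = i + h + 1 -> B (f i) (f j) = Some Blue -> wins 0 B.
Proof.
by move=> cyc jm jE; apply: (wins_chord cyc beats0); lia.
Qed.

(** * Blue cycles of length n + 1 and n + 2 *)

Lemma beats1 : beats 1 (k + 2).
Proof.
move=> B f cyc; rewrite addn2.
have step2 B' i j : coloured_cycle Blue (n + 1) f B' -> j < n + 1 -> j = i + 2 ->
    B' (f i) (f j) = Some Blue -> wins 0 B'.
  by move=> cyc' jm jE; apply: (wins_forced_chord cyc' jm); lia.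
apply: (@wins_query_index 1 f k.+1 B 0 (2 * k - 1) cyc); try lia.
- (* If the second chord is red, the red cycle runs through the even vertices from
     0 to e and through the odd ones from o to 2k - 1; the parity of k decides
     whether o - e is 2k - 3 or 2k - 1, and both lengths work if it is blue. *)
  move=> B1 cyc1 _ red1; pose c := (k - 1) %/ 2.
  pose e := 2 * c; pose o := 2 * k - 1 + 2 * (k - 2 - c).
  apply: (@wins_query_index 1 f k B1 e o cyc1); try lia.
  + move=> B2 cyc2 e2 red2; apply: (@wins_leq (k.-1 + 0)); first lia.
    pose idx i := if i <= c then 2 * i else 2 * k - 1 + 2 * (k - 1 - i).
    apply: (wins_red_index_cycle (idx := idx) cyc2).
    * by move=> i ik; rewrite /idx; case: ifP; lia.
    * by move=> i j ik jk; rewrite /idx; do 2?case: ifP => ?; lia.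
    * move=> i B' ik cyc' e'; rewrite /idx; case: (ltngtP i c) => ic.
      - by apply: step2 => //; lia.
      - by rewrite colour_sym; apply: step2 => //; lia.
      - rewrite ic -/e (_ : _ + _ = o); last lia.
        by rewrite (e' _ _ _ red2).
    * rewrite /idx ifF /=; last lia.
      rewrite colour_sym (_ : _ + _ = 2 * k - 1); last lia.
      exact: e2 red1.
  + move=> B2 cyc2 e2 blue2; apply: (@wins_leq (k.-1 + 0).+1); first lia.
    (* Against the blue chord from [e] to [o], the shifts [k - e] and [3 * k - 2 - o] are 1 and 2,
       in an order set by the parity of [k]. *)
    apply: (@wins_query_index 1 f _ B2 (3 * k - 2) k cyc2); try lia.
    * move=> B3 cyc3 e3 red3.
      apply: (wins_red_index_cycle (idx := fun i => k + 2 * i) cyc3); try lia.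
      - by move=> i B' ik cyc' _; apply: step2 => //; lia.
      - by rewrite (_ : k + 2 * k.-1 = 3 * k - 2) ?muln0 ?addn0 //; lia.
    * move=> B3 cyc3 e3; rewrite colour_sym => blue3; apply: (@wins_leq 0) => //.
      by apply: (wins_crossing cyc3 _ _ _ _ _ (e3 _ _ _ blue2) blue3); lia.
- move=> B1 cyc1 _ blue1; apply: (@wins_leq (k.-1 + 0).+1); first lia.
  apply: (@wins_query_index 1 f _ B1 (2 * k) 2 cyc1); try lia.
  + move=> B2 cyc2 _ red2.
    apply: (wins_red_index_cycle (idx := fun i => 2 + 2 * i) cyc2); try lia.
    * by move=> i B' ik cyc' _; apply: step2 => //; lia.
    * by rewrite (_ : 2 + 2 * k.-1 = 2 * k) ?muln0 ?addn0 //; lia.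
  + move=> B2 cyc2 e2; rewrite colour_sym => blue2; apply: (@wins_leq 0) => //.
    by apply: (wins_crossing cyc2 _ _ _ _ _ (e2 _ _ _ blue1) blue2); lia.
Qed.

Lemma beats2 : beats 2 (k + 1).
Proof.
move=> B f cyc; rewrite addn1.
have step3 B' i j : coloured_cycle Blue (n + 2) f B' -> j < n + 2 -> j = i + 3 ->
    B' (f i) (f j) = Some Blue -> wins 0 B'.
  by move=> cyc' jm jE; apply: (wins_forced_chord cyc' jm); lia.
apply: (@wins_query_index 2 f k B (3 * k - 3) 0 cyc); try lia.
- move=> B1 cyc1 _ red1; apply: (@wins_leq (k.-1 + 0)); first lia.
  apply: (wins_red_index_cycle (idx := fun i => 3 * i) cyc1); try lia.
  + by move=> i B' ik cyc' _; apply: step3 => //; lia.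
  + by rewrite (_ : 3 * k.-1 = 3 * k - 3) //; lia.
- move=> B1 cyc1 _; rewrite colour_sym => blue1.
  apply: (@wins_leq (k.-1 + 0).+1); first lia.
  (* Both ends of the blue chord are shifted by 2, and 2 + 2 is the sum that crossing chords
     need. *)
  apply: (@wins_query_index 2 f _ B1 (3 * k - 1) 2 cyc1); try lia.
  + move=> B2 cyc2 _ red2.
    apply: (wins_red_index_cycle (idx := fun i => 2 + 3 * i) cyc2); try lia.
    * by move=> i B' ik cyc' _; apply: step3 => //; lia.
    * by rewrite (_ : 2 + 3 * k.-1 = 3 * k - 1) //; lia.
  + move=> B2 cyc2 e2; rewrite colour_sym => blue2; apply: (@wins_leq 0) => //.
    by apply: (wins_crossing cyc2 _ _ _ _ _ (e2 _ _ _ blue1) blue2); lia.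
Qed.

(** * Closing red zigzags for general h *)

Lemma wins_near_forced_chord h f (B : board) i j :
  0 < h -> coloured_cycle Blue (n + h) f B -> i < n + h -> j < n + h ->
  [|| j == i + h + 1, i == j + h + 1, j == i + h | i == j + h] ->
  B (f i) (f j) = Some Blue -> wins (k + 2) B.
Proof.
move=> h0 cyc; wlog ij : i j / i < j => [wl|] im jm ijE blue.
  have [ij|ij] := ltnP i j; first exact: wl ijE blue.
  by apply: (wl j i) => //; rewrite 1?colour_sym //; lia.
have [jE|jE] := eqVneq j (i + h + 1).
  by apply: (@wins_leq 0) => //; apply: (wins_forced_chord cyc jm jE blue).
by apply: (wins_chord cyc beats1 ij jm _ blue); lia.
Qed.

(* The path 0, h + 1, 1, h + 2, 2, ... *)
Definition zigzag h i := if i %% 2 == 0 then i %/ 2 else i %/ 2 + h + 1.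

(* The red cycle consists of z and the first k - 1 vertices of the zigzag. *)
Lemma beats_midpoint h z t :
  0 < h -> (k - 2) %/ 2 < z -> z <= h -> 2 * k + 1 <= t ->
  beats (h + 1 - z) t ->
  (forall B f, coloured_cycle Blue (n + h) f B ->
    B (f (zigzag h (k - 2))) (f z) = Some Blue -> wins t B) ->
  beats h t.+2.
Proof.
move=> h0 z_gt z_lt kt beats_z beats_end B f cyc.
have zz_lt i : i < k -> zigzag h i < n + h by rewrite /zigzag; case: ifP; lia.
(* Even positions stay at or below [(k - 2) %/ 2], odd ones start at [h + 1]; [z] lies strictly
   between. *)
have zz_z i : i <= k - 2 -> zigzag h i <> z by rewrite /zigzag; case: ifP; lia.
have zz_inj i j : i <= k - 2 -> j <= k - 2 -> zigzag h i = zigzag h j -> i = j.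
  by rewrite /zigzag; do 2?case: ifP; lia.
apply: (wins_query_index (i := zigzag h (k - 2)) (j := z) cyc).
- by apply: zz_lt; lia.
- by lia.
- by apply: zz_z.
- move=> B1 cyc1 _ red1.
  apply: (wins_query_index (i := 0) (j := z) cyc1); try lia.
  (* The bound 2k + 1 is k - 1 path queries, plus k + 2 rounds if one of them yields a blue chord of
     length [h]. *)
  + move=> B2 cyc2 e2 red2; apply: (@wins_leq (k.-1 + (k + 2))); first lia.
    pose idx i := if i == 0 then z else zigzag h i.-1.
    apply: (wins_red_index_cycle (idx := idx) cyc2).
    * by case=> [|i] ik; rewrite /idx /=; [lia | apply: zz_lt; lia].
    * move=> [|i] [|j] //= ik jk; rewrite /idx /=.
      - by move=> /esym E; case: (zz_z j _ E); lia.
      - by move=> E; case: (zz_z i _ E); lia.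
      - by move=> E; rewrite (zz_inj i j _ _ E); lia.
    * move=> [|i] B' ik cyc' e'; rewrite /idx /=.
        by rewrite colour_sym (e' _ _ _ red2).
      apply: wins_near_forced_chord cyc' _ _ _ => //; try (apply: zz_lt; lia).
      by rewrite /zigzag; do 2?case: ifP; lia.
    * rewrite /idx ifF ?eqxx; last lia.
      by rewrite (_ : k.-1.-1 = k - 2); [exact: e2 red1 | lia].
  + move=> B2 cyc2 _ blue2.
    by apply: (wins_chord cyc2 beats_z _ _ _ blue2); lia.
- by move=> B1 cyc1 _ blue1; apply: (@wins_leq t) => //; apply: beats_end blue1.
Qed.

(* A zigzag fills the interval from 0 to 2h + 1 and ends there; the next one starts
   h + 1 further, so the first k - 1 vertices stay below about 3k / 2 + h even when
   h is much smaller than k. *)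
Definition zigzags h i :=
  i %/ (2 * (h + 1)) * (3 * h + 2) + zigzag h (i %% (2 * (h + 1))).

Lemma zigzags_inj h : injective (zigzags h).
Proof.
move=> i j; rewrite /zigzags.
set q := _ %/ _; set r := _ %% _; set q' := _ %/ _; set r' := _ %% _.
have rP : r < 2 * (h + 1) by rewrite ltn_mod; lia.
have rP' : r' < 2 * (h + 1) by rewrite ltn_mod; lia.
have zz_lt s : s < 2 * (h + 1) -> zigzag h s < 3 * h + 2.
  by rewrite /zigzag; case: ifP; lia.
move=> E.
have qE : q = q'.
  have := congr1 (divn^~ (3 * h + 2)) E.
  by rewrite /= !divnMDl; try lia; rewrite !divn_small ?addn0 //; apply: zz_lt.
have {E} : zigzag h r = zigzag h r' by move: E; rewrite qE; lia.
rewrite (divn_eq i (2 * (h + 1))) (divn_eq j (2 * (h + 1))) -/q -/q' -/r -/r' qE.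
by rewrite /zigzag => rE; congr addn; move: rE; do 2?case: ifP; lia.
Qed.

(** A full block of 2(h + 1) vertices advances by 3h + 2, less than 3/2 per vertex; a partial block
    exceeds that rate by at most h + 1. *)
Lemma zigzags_leq h i : 2 * zigzags h i <= 3 * i + 2 * (h + 1).
Proof.
rewrite /zigzags {3}(divn_eq i (2 * (h + 1))).
set q := _ %/ _; set r := _ %% _.
have : 2 * zigzag h r <= 3 * r + 2 * (h + 1) by rewrite /zigzag; case: ifP; lia.
nia.
Qed.

Lemma zigzags_step h i :
  zigzags h i.+1 = zigzags h i + h + 1 \/ zigzags h i = zigzags h i.+1 + h.
Proof.
rewrite /zigzags.
have [r_lt|] := ltnP (i %% (2 * (h + 1))).+1 (2 * (h + 1)).
  have -> : i.+1 %/ (2 * (h + 1)) = i %/ (2 * (h + 1)).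
    rewrite {1}(divn_eq i (2 * (h + 1))) -addnS divnMDl; last lia.
    by rewrite (divn_small r_lt) addn0.
  have -> : i.+1 %% (2 * (h + 1)) = (i %% (2 * (h + 1))).+1.
    by rewrite {1}(divn_eq i (2 * (h + 1))) -addnS modnMDl modn_small.
  move: (_ %% _) (_ %/ _ * _) r_lt => r c r_lt.
  by rewrite /zigzag; do 2?case: ifP; lia.
have := ltn_pmod i (_ : 0 < 2 * (h + 1)) => /(_ ltac:(lia)) r_lt r_ge.
have rE : i %% (2 * (h + 1)) = 2 * h + 1 by lia.
have iE : i.+1 = (i %/ (2 * (h + 1))).+1 * (2 * (h + 1)).
  by rewrite {1}(divn_eq i (2 * (h + 1))) rE mulSn; lia.
rewrite iE mulnK; last lia.
(* A block ends at 2h + 1 and the next starts at 3h + 2. *)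
left; rewrite modnMl rE /zigzag mod0n div0n mulSn /=.
by case: ifP; lia.
Qed.

Lemma beats_small h : 1 < h -> 3 * (h + k) < 2 * n -> beats h (2 * k + 3).
Proof.
move=> h1 h_small B f cyc.
pose d := h + 1 + zigzags h (k - 2).
(* The largest index is at most (5h + 3k) / 2, which is below n + h exactly when 3(h + k) < 2n. *)
have lt_m i c : i <= k - 2 -> c <= (h + 2) %/ 2 ->
    c + (h + 1) + zigzags h i < n + h.
  by move=> ik ch; have := zigzags_leq h i; lia.
(* The crossing chord shifts the ends of the path by u and v with u + v = h + 2;
     when h is odd, u = v + 1 and the first step has length h instead of h + 1. *)
have close B' u v t : coloured_cycle Blue (n + h) f B' ->
    v <= u -> u <= v + 1 -> v <= (h + 2) %/ 2 ->
    (forall B1, coloured_cycle Blue (n + h) f B1 -> extends B' B1 ->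
     B1 (f (v + d)) (f u) = Some Blue -> wins t B1) ->
    2 * k + 1 <= t -> wins t.+1 B'.
  move=> cyc' vu uv vh blue kt.
  apply: (wins_query_index (i := v + d) (j := u) cyc') => //.
  - by rewrite /d addnA; apply: lt_m.
  - lia.
  - by lia.
  - move=> B1 cyc1 _ red1; apply: (@wins_leq (k.-1 + (k + 2))); first lia.
    pose idx i := if i == 0 then u else v + (h + 1) + zigzags h i.-1.
    apply: (wins_red_index_cycle (idx := idx) cyc1).
    * by case=> [|i] ik; rewrite /idx /=; [lia | apply: lt_m; lia].
    * move=> [|i] [|j] //= ik jk; rewrite /idx /=; try lia.
      by move=> ijE; congr S; apply: (@zigzags_inj h); lia.
    * move=> [|i] B2 ik cyc2 _; rewrite /idx /=.
        apply: wins_near_forced_chord cyc2 _ _ _; try lia.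
          by apply: lt_m.
        by rewrite /zigzags div0n mod0n /zigzag /=; lia.
      apply: wins_near_forced_chord cyc2 _ _ _; try (apply: lt_m); try lia.
      by have := zigzags_step h i; lia.
    * rewrite /idx ifF ?eqxx; last lia.
      by rewrite -addnA (_ : k.-1.-1 = k - 2); [exact: red1 | lia].
rewrite addnS.
apply: (close B 0 0) => //; last lia.
move=> B1 cyc1 _; rewrite colour_sym add0n => blue1; rewrite addnS.
apply: (close B1 ((h + 3) %/ 2) ((h + 2) %/ 2)) => //; try lia.
move=> B2 cyc2 e2; rewrite colour_sym => blue2; apply: (@wins_leq 0) => //.
apply: (wins_crossing cyc2 _ _ _ _ _ (e2 _ _ _ blue1) blue2); try lia.
by rewrite /d addnA; apply: lt_m.
Qed.

(** * Reducing h, by parity of k *)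

Lemma beats_base h : h <= 2 \/ 3 * (h + k) < 2 * n -> beats h (2 * k + 3).
Proof.
move=> h_small; case: (ltnP h 3) => [h_lt3|h_ge3]; last by apply: beats_small; lia.
case: h h_lt3 {h_small} => [|[|[|]]] // _.
- exact: beats_leq beats0.
- by apply: beats_leq beats1; lia.
- by apply: beats_leq beats2; lia.
Qed.

(** The zigzag ends at k/2 - 1, so from z = h the two chords have lengths h and h + 1 - k/2; a blue
    one leads to 1 or k/2, both base cases. *)
Lemma beats_even h : k %% 2 = 0 -> beats h (2 * k + 5).
Proof.
move=> k_even; have [h_le|h_gt] := leqP h (k %/ 2).
  by apply: (@beats_leq _ (2 * k + 3)); [lia | apply: beats_base; lia].
rewrite 2!addnS; apply: (@beats_midpoint h h); try lia.
  by apply: beats_base; lia.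
move=> B f cyc blue.
apply: (wins_chord (h' := k %/ 2) cyc _ _ _ _ blue).
- by apply: beats_base; lia.
- by rewrite /zigzag ifT; lia.
- lia.
- by rewrite /zigzag ifT; lia.
Qed.

(** The zigzag ends at (k - 3)/2 + h + 1 and z is the midpoint between 0 and that end, so either
    chord, if blue, leaves at most (h + 1)/2, rounded up. *)
Lemma beats_double h N t : k %% 2 = 1 -> (k - 3) %/ 2 < h -> h < 2 * N ->
  2 * k + 1 <= t -> (forall h', h' <= N -> beats h' t) -> beats h t.+2.
Proof.
move=> k_odd h_gt hN kt win.
apply: (@beats_midpoint h ((h + 1 + (k - 3) %/ 2) %/ 2)); try lia.
  by apply: win; lia.
move=> B f cyc; rewrite colour_sym => blue.
have zE : zigzag h (k - 2) = (k - 3) %/ 2 + h + 1 by rewrite /zigzag ifF; lia.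
rewrite zE in blue.
pose h' := h + 1 - (zigzag h (k - 2) - (h + 1 + (k - 3) %/ 2) %/ 2).
by apply: (wins_chord (h' := h') cyc _ _ _ _ blue); rewrite /h'; [apply: win|..]; lia.
Qed.

(** The final + 1 survives halving: for N = 2^d M + 1, the condition h < 2N reads h <= 2^(d+1) M +
    1. *)
Lemma beats_odd d h : k %% 2 = 1 ->
  h <= 2 ^ d * (1 + n %/ 16) + 1 -> beats h (2 * k + 3 + 2 * d).
Proof.
move=> k_odd; elim: d h => [|d IH] h h_le.
  by rewrite muln0 addn0; apply: beats_base; lia.
have [h_small|h_gt] := leqP h ((k - 3) %/ 2).
  by apply: (@beats_leq _ (2 * k + 3)); [lia | apply: beats_base; lia].
rewrite mulnS addnCA.
apply: (@beats_double h (2 ^ d * (1 + n %/ 16) + 1)) => //; try lia.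
by rewrite expnS in h_le; lia.
Qed.

Lemma beats_upto_2n h : h <= 2 * n -> beats h (3 * k + 10).
Proof.
move=> h_le; case: (eqVneq (k %% 2) 0) => k_parity.
  by apply: (@beats_leq _ (2 * k + 5)); [lia | exact: beats_even].
(* Here 32(1 + n %/ 16) exceeds 2n, and 2k + 13 <= 3k + 10 since k >= 3. *)
by apply: (@beats_leq _ (2 * k + 3 + 2 * 5)); [lia | apply: beats_odd; lia].
Qed.

End Strategy.

(** * From the drawn cycle to the least number of rounds *)

Lemma drawn_cycle m B : 1 < m ->
  drawing (monochromatic Blue (cycle_graph m)) B ->
  exists f, coloured_cycle Blue m f B.
Proof.
move=> m_gt1 [f [f_inj f_edge _]].
have m_gt0 : 0 < m by lia.
pose ord i := Ordinal (ltn_pmod i m_gt0).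
have edge i j : i <> j -> i < m -> j < m -> j = i.+1 %% m ->
    B (f (ord i)) (f (ord j)) = Some Blue.
  move=> ij im jm jE; rewrite f_edge /= /mono_colour /= /cycle_adj.
  rewrite -!val_eqE /= !(modn_small im) !(modn_small jm) -jE eqxx /=.
  by rewrite ifT //; apply/andP; split=> //; apply/eqP.
exists (fun i => f (ord i)); split.
- move=> i j im jm /f_inj/(congr1 val) /=.
  by rewrite !modn_small.
- by move=> i im; apply: edge; rewrite ?modn_small; lia.
- apply: edge; try lia.
  by rewrite (_ : m.-1.+1 = m) ?modnn //; lia.
Qed.

Lemma ex_least (P : nat -> Prop) t : P t ->
  exists2 r, P r /\ (forall s, P s -> r <= s) & r <= t.
Proof.
elim/ltn_ind: t => t IH Pt.
have [[s s_lt Ps]|least] := classic (exists2 s, s < t & P s).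
  by have [r rP rs] := IH s s_lt Ps; exists r => //; lia.
exists t => //; split=> // s Ps; rewrite leqNgt; apply/negP => s_lt.
by apply: least; exists s.
Qed.

Theorem theorem4 (k n h : nat) (hk : 3 <= k) (hn : 3 * k - 3 < n)
    (hh : h <= 2 * n) :
  exists2 r : nat,
    is_online_ramsey_number (cycle_graph k) (cycle_graph n)
      (monochromatic Blue (cycle_graph (n + h))) r
    & r <= 3 * k + 10.
Proof.
apply: ex_least => B /drawn_cycle[|f cyc]; first lia.
exact: (beats_upto_2n hk hn hh cyc).
Qed.
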